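(* For every finite simple graph $G$, it holds that \[\sigma_{\mathbb{T}}(G)=\sup_{Z}\sigma_Z(G),\] where the supremum is taken over all finite abelian groups $Z$.
   Context: For an abelian group $Z$ and a graph $G$, a set $A\subseteq Z$ is a coloring $Z$-base for $G$ if there exists a function $f:V(G)\to Z$ such that the sets $A+f(u)$ and $A+f(v)$ are disjoint for every edge $uv$ of $G$. For a compact abelian topological group $Z$ with Haar probability measure $\mu$, define $\sigma_Z(G)=\sup\{\mu(A): A \text{ is a Borel coloring } Z\text{-base for } G\}$. Here $\mathbb{T}=\mathbb{R}/\mathbb{Z}$ with its Haar (Lebesgue) probability measure, and a finite abelian group carries the discrete topology and the uniform probability measure. *)

(* Defs.v *)
From HB Require Import structures.
From mathcomp Require Import all_boot all_order all_algebra.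
From mathcomp Require Import all_classical all_reals all_analysis.
From mathcomp Require Import finmap measurable_realfun lra.
Set Implicit Arguments.
Unset Strict Implicit.
Unset Printing Implicit Defensive.
Import Order.TTheory GRing.Theory Num.Theory.
Import numFieldNormedType.Exports.
Local Open Scope classical_set_scope.
Local Open Scope ring_scope.

Definition translate (Z : zmodType) (A : set Z) (z : Z) : set Z :=
  [set a + z | a in A].

(* The graph has vertex set [V] and an edge [uv] whenever [e u v]. *)
Definition coloring_base (V : finType) (e : rel V) (Z : zmodType) (A : set Z) :=
  exists f : V -> Z,
    forall u v, e u v -> translate A (f u) `&` translate A (f v) = set0.

(* [borel Z] is [Z] with the sigma-algebra generated by its open sets; the base
   point 0 is only there because the sigma-algebra construction of the library
   requires a pointed type. *)
Definition borel (Z : topologicalZmodType) : Type := Z.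

HB.instance Definition _ (Z : topologicalZmodType) := Choice.on (borel Z).
HB.instance Definition _ (Z : topologicalZmodType) := isPointed.Build (borel Z) 0.
HB.instance Definition _ (Z : topologicalZmodType) :=
  @isMeasurable.Build (sigma_display (@open Z)) (borel Z)
    <<s @open Z >> (@sigma_algebra0 _ setT (@open Z))
    (@sigma_algebraC (borel Z) (@open Z))
    (@sigma_algebra_bigcup _ setT (@open Z)).

(* For a general compact group one would also ask for regularity. The groups
   considered below are the circle and the finite discrete groups; they are
   compact and metrizable, so that every Borel probability measure on them is
   regular and the invariant one is unique. *)
Record haarProbability (Z : topologicalZmodType) (R : realType) :=
  HaarProbability {
    haar_measure :> probability (borel Z) R ;
    haar_invariant : forall (A : set (borel Z)) (z : Z), measurable A ->
      haar_measure (translate A z) = haar_measure A }.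

Definition sigma (R : realType) (Z : topologicalZmodType)
    (mu : haarProbability Z R) (V : finType) (e : rel V) : \bar R :=
  ereal_sup [set mu A | A in [set A : set (borel Z) |
    measurable A /\ coloring_base e A]].

Definition integers (R : realType) : zmodClosed R :=
  GRing.ZmodClosed.clone R (@Num.int_num_subdef R) _.

Definition circle (R : realType) : Type := Quotient.quot (integers R).

HB.instance Definition _ (R : realType) := GRing.Zmodule.on (circle R).

Definition to_circle (R : realType) (x : R) : circle R :=
  (\pi_(Quotient.quot (integers R)) x)%qT.

Section circle_topology.
Variable R : realType.

(* This is the quotient topology; the alias [quotient_topology] is not used
   because its choice structure is not convertible to the one on which the group
   structure of [Quotient.quot] is built. *)
Definition circle_open (U : set (circle R)) := open (@to_circle R @^-1` U).

Let circle_openT : circle_open setT.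
Proof. by rewrite /circle_open preimage_setT; exact: openT. Qed.

Let circle_openI : setI_closed circle_open.
Proof. by move=> ? ? ? ?; exact: openI. Qed.

Let circle_open_bigU (I : Type) (f : I -> set (circle R)) :
  (forall i, circle_open (f i)) -> circle_open (\bigcup_i f i).
Proof. by move=> fo; apply: bigcup_open => i _; exact: fo. Qed.

HB.instance Definition _ := isOpenTopological.Build (circle R)
  circle_openT circle_openI circle_open_bigU.

End circle_topology.

Section circle_lemmas.
Variable R : realType.
Implicit Types (x y : R).
Local Notation pi := (@to_circle R).

Lemma to_circleD x y : pi (x + y) = pi x + pi y.
Proof. exact: (raddfD (\pi_(Quotient.quot (integers R)))%qT). Qed.

Lemma to_circleN x : pi (- x) = - pi x.
Proof. exact: (raddfN (\pi_(Quotient.quot (integers R)))%qT). Qed.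

Lemma to_circle_eq x y : pi x = pi y <-> x - y \is a Num.int.
Proof.
have xyE := Quotient.idealrBE (integers R) x y.
by split=> [/(introT eqP)|xy]; [rewrite -xyE|apply/eqP; rewrite -xyE].
Qed.

Lemma to_circle_surj (c : circle R) : exists x, pi x = c.
Proof. by exists (repr c); exact: (@reprK _ (Quotient.quot (integers R))). Qed.

Lemma to_circle_continuous : continuous pi.
Proof. exact/continuousP. Qed.

Lemma open_circleE (U : set (circle R)) : open U = open (pi @^-1` U).
Proof. by []. Qed.

Lemma to_circle_open (U : set R) : open U -> open (pi @` U).
Proof.
move=> oU; rewrite open_circleE.
have -> : pi @^-1` (pi @` U) = \bigcup_(n : int) ((fun x => x + n%:~R) @^-1` U).
  apply/seteqP; split=> [x [y Uy /to_circle_eq/intrP[n yxn]]|x [n _ /= Uxn]].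
    by exists n => //=; rewrite -yxn addrC subrK.
  exists (x + n%:~R) => //; apply/to_circle_eq.
  by rewrite addrC addKr intr_int.
apply: bigcup_open => n _; apply: open_comp oU => x _.
by apply: continuousD; [exact: cvg_id|exact: cvg_cst].
Qed.

Lemma nbhs_to_circle x (U : set (circle R)) :
  nbhs (pi x) U <-> nbhs x (pi @^-1` U).
Proof.
split; first exact: to_circle_continuous.
rewrite !nbhsE => -[W [oW Wx] WU].
exists (pi @` W); first by split; [exact: to_circle_open|exists x].
by move=> _ [y Wy <-]; exact: WU.
Qed.

Let sub_circle_continuous : continuous (fun c : circle R * circle R => c.1 - c.2).
Proof.
move=> [a b]; have [x <-] := to_circle_surj a; have [y <-] := to_circle_surj b.
move=> U /=; rewrite /= -to_circleN -to_circleD => /nbhs_to_circle Uxy.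
have /= := @sub_continuous R^o (x, y) _ Uxy.
move=> [[P Q] /= [Px Qy] PQ].
exists (pi @` P, pi @` Q) => /=.
  by split; apply/nbhs_to_circle; [apply: filterS Px|apply: filterS Qy] => z;
    exists z.
move=> [_ _] /= [[p Pp <-] [q Qq <-]].
by have := PQ (p, q) (conj Pp Qq); rewrite /= to_circleD to_circleN.
Qed.

HB.instance Definition _ :=
  PreTopologicalNmodule_isTopologicalZmodule.Build (circle R)
    sub_circle_continuous.

Lemma to_circle_repr (c : circle R) : exists2 x, x \in `[0, 1[ & pi x = c.
Proof.
have [x <-] := to_circle_surj c; exists (x - (Num.floor x)%:~R).
  rewrite in_itv/= subr_ge0 Num.Theory.floor_le ltrBlDr addrC.
  by have := Num.Theory.floorD1_gt x; rewrite intrD.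
by apply/to_circle_eq; rewrite addrC addKr rpredN intr_int.
Qed.

Lemma circle_compact : compact [set: circle R].
Proof.
have -> : [set: circle R] = pi @` `[0, 1].
  apply/seteqP; split=> // c _; have [x x01 <-] := to_circle_repr c.
  exists x => //=; move: x01; rewrite !in_itv/= => /andP[->] /ltW ->.
  by [].
apply: continuous_compact; last exact: segment_compact.
exact/continuous_subspaceT/to_circle_continuous.
Qed.

End circle_lemmas.

Section translation.
Variable R : realType.
Local Notation mu := (@lebesgue_measure R).

Lemma measurable_shift (r : R) :
  measurable_fun setT ((fun x => x + r) : measurableTypeR R -> measurableTypeR R).
Proof.
by apply: measurable_funD => //; exact: measurable_id.
Qed.

Lemma lebesgue_measure_shift (r : R) (A : set (measurableTypeR R)) :
  measurable A -> mu ((fun x => x + r) @^-1` A) = mu A.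
Proof.
move=> mA; pose m :=
  measure_function_pushforward__canonical__measure_function_Measure mu
    (measurable_shift r).
rewrite (_ : mu (_ @^-1` A) = m A)//.
apply/esym/lebesgue_measure_unique => // _ [[a b]] _ <-.
rewrite /m/= /pushforward.
have -> : (fun x => x + r) @^-1` `]a, b] = `]a - r, b - r]%classic.
  by apply/seteqP; split=> x; rewrite /= !in_itv/= ltrBlDr lerBrDr.
rewrite !lebesgue_measure_itv/= !lte_fin ltrD2r.
by case: ifP => // _; rewrite -!EFinB opprB addrA subrK.
Qed.

(* The image under [to_circle] of Lebesgue measure on the fundamental domain. *)
Definition circle_measure (A : set (borel (circle R))) : \bar R :=
  mu (@to_circle R @^-1` A `&` `[0, 1[).

Lemma measurable_to_circle : measurable_fun setT
  (@to_circle R : measurableTypeR R -> borel (circle R)).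
Proof.
apply: (@measurability _ _ (measurableTypeR R) (borel (circle R)) setT _
  (@open (circle R))) => [//|_] [U oU <-].
rewrite setTI; apply: open_measurable; exact: oU.
Qed.

Let mpre (A : set (borel (circle R))) : measurable A ->
  measurable (@to_circle R @^-1` A : set (measurableTypeR R)).
Proof. by move=> mA; rewrite -[X in measurable X]setTI; exact: measurable_to_circle. Qed.

Let circle_measure0 : circle_measure set0 = 0%E.
Proof. by rewrite /circle_measure preimage_set0 set0I measure0. Qed.

Let circle_measure_ge0 A : (0 <= circle_measure A)%E.
Proof. exact: measure_ge0. Qed.

Let circle_measure_additive : semi_sigma_additive circle_measure.
Proof.
move=> F mF tF mUF; rewrite /circle_measure preimage_bigcup setI_bigcupl.
apply: measure_semi_sigma_additive.
- by move=> n; apply: measurableI => //; exact: mpre.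
- apply: trivIset_setIr.
  apply/trivIsetP => i j _ _ ij; rewrite -preimage_setI.
  by move/trivIsetP : tF => /(_ _ _ _ _ ij) ->//; rewrite preimage_set0.
- rewrite -setI_bigcupl -preimage_bigcup.
  by apply: measurableI => //; exact: mpre.
Qed.

HB.instance Definition _ := isMeasure.Build _ _ _ circle_measure
  circle_measure0 circle_measure_ge0 circle_measure_additive.

Let circle_measureT : circle_measure setT = 1%E.
Proof.
rewrite /circle_measure preimage_setT setTI lebesgue_measure_itv/= lte_fin ltr01.
by rewrite oppr0 adde0.
Qed.

HB.instance Definition _ :=
  Measure_isProbability.Build _ _ _ circle_measure circle_measureT.

Lemma circle_measure_invariant (A : set (borel (circle R))) (z : circle R) :
  measurable A -> circle_measure (translate A z) = circle_measure A.
Proof.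
move=> mA; have [r r01 <-{z}] := to_circle_repr z.
rewrite /circle_measure; set B := @to_circle R @^-1` A.
have mB : measurable (B : set (measurableTypeR R)) by exact: mpre.
have -> : @to_circle R @^-1` translate A (to_circle r) `&` `[0, 1[ =
    (fun x => x + - r) @^-1` (B `&` `[- r, 1 - r[).
  apply/seteqP; split => x /=; rewrite !in_itv/= !lerBrDr !ltrBlDr addNr subrK.
    move=> [[a Aa axr] x01]; split=> //; rewrite /B/= to_circleD to_circleN.
    by rewrite -axr addrK.
  move=> [Bx x01]; split=> //; exists (to_circle (x - r)) => //.
  by rewrite to_circleD to_circleN subrK.
rewrite (lebesgue_measure_shift (- r)); last exact: measurableI.
have -> : B `&` `[- r, 1 - r[ =
    (fun x => x + 1) @^-1` (B `&` `[1 - r, 1[) `|` (B `&` `[0, 1 - r[).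
  have B1 x : B (x + 1) = B x.
    rewrite /B/=; congr A; apply/to_circle_eq.
    by rewrite addrC addKr.
  move: r01; rewrite in_itv/= => /andP[r0 r1].
  apply/seteqP; split => x /=; rewrite !in_itv/=.
    move=> [Bx /andP[rx xr]]; have [x0|x0] := ltP x 0.
      by left; rewrite B1; split=> //; apply/andP; split; lra.
    by right; split.
  by rewrite B1 => -[[Bx /andP[? ?]]|[Bx /andP[? ?]]]; split=> //;
    apply/andP; split; lra.
rewrite measureU; last 3 first.
- rewrite -[X in measurable X]setTI; apply: measurable_shift => //.
  exact: measurableI.
- exact: measurableI.
- apply/seteqP; split=> // x /=; rewrite !in_itv/=.
  by move=> [[_ /andP[_ ?]] [_ /andP[? _]]]; lra.
rewrite [X in (X + _)%E](lebesgue_measure_shift 1); last exact: measurableI.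
rewrite addeC -measureU; last 3 first.
- exact: measurableI.
- exact: measurableI.
- apply/seteqP; split=> // x /=; rewrite !in_itv/=.
  by move=> [[_ /andP[_ ?]] [_ /andP[? _]]]; lra.
rewrite -setIUr; congr (mu (B `&` _)).
move: r01; rewrite in_itv/= => /andP[r0 r1].
apply/seteqP; split=> x /=; rewrite !in_itv/=.
  by move=> [/andP[? ?]|/andP[? ?]]; apply/andP; split; lra.
move=> /andP[x0 x1]; have [?|?] := ltP x (1 - r); [left|right];
  apply/andP; split; lra.
Qed.

Definition circle_haar : haarProbability (circle R) R :=
  HaarProbability circle_measure_invariant.

End translation.

HB.instance Definition _ (Z : zmodType) :=
  GRing.Zmodule.copy (discrete_topology Z) Z.

Lemma discrete_sub_continuous (Z : zmodType) :
  continuous (fun x : discrete_topology Z * discrete_topology Z => x.1 - x.2).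
Proof.
move=> [x y] U /= /nbhs_singleton/= Uxy.
exists ([set x], [set y]) => /=; last by move=> [_ _] /= [-> ->].
by split; apply/principal_filterP.
Qed.

HB.instance Definition _ (Z : zmodType) :=
  PreTopologicalNmodule_isTopologicalZmodule.Build (discrete_topology Z)
    (@discrete_sub_continuous Z).

Section uniform.
Variables (R : realType) (Z : finZmodType).
Local Notation Zd := (borel (discrete_topology Z)).

Definition uniform_measure (A : set Zd) : \bar R :=
  (#|[pred z : Z | z \in A]|%:R / #|Z|%:R)%:E.

Lemma measurable_finite (A : set Zd) : measurable A.
Proof. by apply: sub_sigma_algebra; exact: discrete_open. Qed.

Lemma uniform_measureE :
  uniform_measure = mscale (#|Z|%:R^-1)%:nng (counting : set Zd -> \bar R).
Proof.
apply/funext => A; rewrite /mscale/=.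
have fA : finite_set A by exact: (@sub_finite_set _ _ _ _ (@finite_finset Z setT)).
rewrite /counting asboolT// /uniform_measure mulrC EFinM; congr (_ * (_%:R)%:E)%E.
rewrite cardE; apply: perm_size; apply: uniq_perm.
- exact: enum_uniq.
- exact: fset_uniq.
by move=> x; rewrite mem_enum in_fset_set.
Qed.

Let uniform0 : uniform_measure set0 = 0%E.
Proof. by rewrite uniform_measureE measure0. Qed.

Let uniform_ge0 A : (0 <= uniform_measure A)%E.
Proof. by rewrite uniform_measureE measure_ge0. Qed.

Let uniform_additive : semi_sigma_additive uniform_measure.
Proof. by rewrite uniform_measureE; exact: measure_semi_sigma_additive. Qed.

HB.instance Definition _ := isMeasure.Build _ _ _ uniform_measure
  uniform0 uniform_ge0 uniform_additive.

Let uniformT : uniform_measure setT = 1%E.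
Proof.
rewrite /uniform_measure (eq_card (B := Z)); last first.
  by move=> x; rewrite !inE; exact/mem_set.
by rewrite divff// pnatr_eq0 -lt0n; apply/card_gt0P; exists 0.
Qed.

HB.instance Definition _ :=
  Measure_isProbability.Build _ _ _ uniform_measure uniformT.

Lemma uniform_measure_invariant (A : set Zd) (z : discrete_topology Z) :
  measurable A -> uniform_measure (translate A z) = uniform_measure A.
Proof.
move=> _; rewrite /uniform_measure; congr ((_%:R / _)%:E).
rewrite -[RHS](fintype.card_image (@addIr Z z)).
apply: eq_card => x; rewrite !inE; apply/idP/fintype.imageP => /=.
  by move=> /set_mem[a Aa <-]; exists a => //; rewrite inE; exact/mem_set.
by move=> [a /set_mem Aa ->]; apply/mem_set; exists a.
Qed.

Definition uniform_haar : haarProbability (discrete_topology Z) R :=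
  HaarProbability uniform_measure_invariant.

End uniform.

(* Main.v *)
(* Both the circle and every finite abelian group are compared with cyclic groups.
   Let [A] be a coloring base of a group [Z] with translations [f], and let [phi]
   be the homomorphism from the free group Z^V to [Z] sending the basis vector of
   [v] to [f v]. For each [x] in [Z], the set of the [z] with [x + phi z] in [A]
   is a coloring base of Z^V, with the basis vectors as translations. Its
   restriction to the box [0, n)^V becomes, by reading vectors as numbers in base
   n + 1, a coloring base of a cyclic group of order (n + 1)^|V|, and the
   invariance of [mu] shows that its average cardinality over [x] is
   n^|V| mu(A). Letting n grow, sigma of [Z] is at most the supremum of sigma over
   cyclic groups. A coloring base of Z/m in turn thickens
   to a union of arcs of length 1/m of the circle with the same measure. *)
Require Import Defs.
From mathcomp Require Import all_boot all_order all_algebra.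
From mathcomp Require Import all_classical all_reals all_analysis.
From mathcomp Require Import measurable_realfun zify lra ring.
Import Order.TTheory GRing.Theory Num.Theory.
Import numFieldNormedType.Exports.
Local Open Scope classical_set_scope.

(** * Digit expansions in a fixed base *)

Section radix.
Context {V : eqType}.
Variable b : nat.
Implicit Types (s : seq V) (a c : V -> nat).

(** The least significant digit comes first. Digits may exceed [b], which makes the value additive
    in [a]. *)
Definition radix_value s a : nat := foldr (fun v m => a v + b * m)%N 0%N s.

Lemma radix_valueD s a c :
  radix_value s (fun v => a v + c v)%N = (radix_value s a + radix_value s c)%N.
Proof. by elim: s => //= v s ->; rewrite mulnDr addnACA. Qed.

Lemma radix_value_lt s a :
  (forall v, a v < b)%N -> (radix_value s a < b ^ size s)%N.
Proof.
move=> ab; elim: s => //= v s IHs; rewrite expnS.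
by apply: leq_trans (leq_mul (leqnn b) IHs); rewrite mulnS ltn_add2r.
Qed.

Lemma radix_value_inj s a c : (forall v, a v < b)%N -> (forall v, c v < b)%N ->
  radix_value s a = radix_value s c -> {in s, a =1 c}.
Proof.
move=> ab cb; elim: s => //= v s IHs acE w.
have b0 : (0 < b)%N by exact: leq_ltn_trans (ab v).
have avcv : a v = c v.
  (* Reduction modulo [b] isolates the first digit. *)
  have := congr1 (modn^~ b) acE.
  by rewrite /= ![(_ + b * _)%N]addnC ![(b * _)%N]mulnC !modnMDl !modn_small.
rewrite inE => /predU1P[->//|]; apply: IHs.
by move: acE; rewrite avcv => /addnI/eqP; rewrite eqn_pmul2l// => /eqP.
Qed.

End radix.

(** * Averaging over a probability space, and translates of Borel sets *)

Section averaging.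
Local Open Scope ring_scope.

(** Integrate the sum of the indicators of the [S i]: at [x] it counts the [i] with [x] in [S i],
    and [P] has total mass 1. *)
Lemma sum_measure_le d (T : measurableType d) (R : realType)
    (P : probability T R) (I : finType) (S : I -> set T) (c : R) :
  (forall i, measurable (S i)) ->
  (forall x, (#|[pred i | x \in S i]|%:R <= c)) ->
  (\sum_i P (S i) <= c%:E)%E.
Proof.
move=> mS Sc.
have -> : (\sum_i P (S i) = \int[P]_x \sum_i (\1_(S i) x)%:E)%E.
  rewrite ge0_integral_sum//; last first.
    by move=> i; exact/measurable_EFinP/measurable_indic.
  by apply: eq_bigr => i _; rewrite integral_indic// setIT.
rewrite -[leRHS]mule1 -(probability_setT P) -integral_cst//.
apply: ge0_le_integral => //.
- by move=> x _; exact: sume_ge0.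
- apply: emeasurable_sum => i.
  by exact/measurable_EFinP/measurable_indic.
move=> x _; rewrite sumEFin lee_fin; apply: le_trans (Sc x).
rewrite -sum1_card natr_sum [leRHS]big_mkcond/=.
by apply: ler_sum => i _; rewrite indicE !inE; case: (x \in S i).
Qed.

Lemma measurable_translate (Z : topologicalZmodType) (A : set (borel Z)) (z : Z) :
  measurable A -> measurable (translate A z : set (borel Z)).
Proof.
move=> mA; have -> : translate A z = (fun x => x - z) @^-1` A.
  apply/seteqP; split => [_ [a Aa <-]|x /= Axz]; first by rewrite /= addrK.
  by exists (x - z) => //; rewrite subrK.
have mf : measurable_fun setT ((fun x : Z => x - z) : borel Z -> borel Z).
  apply: (@measurability _ _ (borel Z) (borel Z) setT _ (@open Z))
    => [//|_ [U oU <-]].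
  rewrite setTI; apply: sub_sigma_algebra.
  have cz : continuous (fun x : Z => x - z).
    move=> x; apply: (@continuous_comp _ _ _ (fun x => (x, z)) (fun p => p.1 - p.2)).
      by apply: cvg_pair; [exact: cvg_id|exact: cvg_cst].
    exact: sub_continuous.
  by move/continuousP : cz; apply.
by rewrite -[X in measurable X]setTI; exact: mf.
Qed.

End averaging.

(** * From a group to a cyclic group *)

Section cyclic_comparison.
Local Open Scope ring_scope.

Lemma translate_disjointP (V : finType) (e : rel V) (Z : zmodType) (A : set Z)
    (f : V -> Z) :
  (forall u v, e u v -> translate A (f u) `&` translate A (f v) = set0) <->
  (forall u v a b, e u v -> A a -> A b -> a + f u <> b + f v).
Proof.
split=> [fA u v a b /fA uv Aa Ab abE|fA u v uv].
  have : (translate A (f u) `&` translate A (f v)) (a + f u).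
    by split; [exists a|rewrite abE; exists b].
  by rewrite uv.
apply/seteqP; split=> // _ [[a Aa <-] [b Ab /esym]].
exact: fA.
Qed.

Section bounds.
Variables (R : realType) (Z : topologicalZmodType) (mu : haarProbability Z R).
Variables (V : finType) (e : rel V).

Lemma sigma_ge0 : (0 <= sigma mu e)%E.
Proof.
apply: ereal_sup_ubound; exists set0; last exact: measure0.
split=> //; exists (fun=> 0); apply/translate_disjointP.
by [].
Qed.

Lemma sigma_le1 : (sigma mu e <= 1)%E.
Proof.
by apply: ge_ereal_sup => _ [A [mA _] <-]; exact: probability_le1.
Qed.

Lemma sigma_fin_num : sigma mu e \is a fin_num.
Proof.
by rewrite ge0_fin_numE ?sigma_ge0// (le_lt_trans sigma_le1)// ltry.
Qed.

End bounds.

(* Base [n.+1] for digits less than [n]: the extra digit value prevents carries when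
   a basis vector is added. *)
Lemma sigma_cyclic_box (R : realType) (Z : topologicalZmodType)
    (mu : haarProbability Z R) (V : finType) (e : rel V) (n m : nat)
    (A : set (borel Z)) : m.+1 = (n.+1 ^ #|V|)%N ->
  measurable A -> coloring_base e A ->
  ((n ^ #|V|)%:R%:E * mu A <=
   m.+1%:R%:E * sigma (uniform_haar R 'I_m.+1) e)%E.
Proof.
move=> mE mA [f /translate_disjointP fA].
pose rho := radix_value n.+1 (enum V).
pose phi (a : V -> nat) : Z := \sum_v f v *+ a v.
pose delta (u v : V) : nat := (v == u).
have phiD a u : phi (fun v => a v + delta u v)%N = phi a + f u.
  rewrite /phi; under eq_bigr do rewrite mulrnDr.
  rewrite big_split/=; congr (_ + _).
  rewrite (bigD1 u)//= /delta eqxx big1 ?addr0// => v /negbTE vu.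
  by rewrite vu.
have rho_lt a : (forall v, a v < n.+1)%N -> (rho a < m.+1)%N.
  by move=> an; rewrite mE cardE; exact: radix_value_lt.
have rho_inj a c : (forall v, a v < n.+1)%N -> (forall v, c v < n.+1)%N ->
    rho a = rho c -> a = c.
  move=> an cn /(radix_value_inj _ _ _ _ an cn) ac.
  by apply/funext => v; apply: ac; rewrite mem_enum.
(* Adding a basis vector keeps every digit at most [n], so both codes stay below the modulus and
   their congruence is an equality of vectors. *)
have phi_eq a c u v : (forall w, a w < n)%N -> (forall w, c w < n)%N ->
    inZp (rho a) + inZp (rho (delta u)) =
    inZp (rho c) + inZp (rho (delta v)) :> 'I_m.+1 ->
    phi a + f u = phi c + f v.
  have D_lt a' u' : (forall w, a' w < n)%N ->
      forall w, (a' w + delta u' w < n.+1)%N.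
    move=> /[swap] w /(_ w) aw; rewrite /delta; case: (w == u').
      by rewrite addn1 ltnS.
    by rewrite addn0 ltnW// ltnS.
  move=> an cn /(congr1 val)/=.
  rewrite !modnDm -!radix_valueD !modn_small; last 2 first.
  - exact/rho_lt/D_lt.
  - exact/rho_lt/D_lt.
  by move=> /(rho_inj _ _ (D_lt _ _ an) (D_lt _ _ cn)) acE; rewrite -!phiD acE.
pose dig (z : {ffun V -> 'I_n}) v : nat := z v.
(* The roles are swapped: for fixed [z], the points [x] with [x + phi z] in [A] form a translate of
   [A], of measure [mu A]. *)
pose S (z : {ffun V -> 'I_n}) : set (borel Z) := translate A (- phi (dig z)).
have SE x z : S z x <-> A (x + phi (dig z)).
  split; first by move=> [a Aa <-]; rewrite subrK.
  by move=> Axz; exists (x + phi (dig z)) => //; rewrite addrK.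
have mS z : measurable (S z) by exact: measurable_translate.
have muS z : mu (S z) = mu A by exact: haar_invariant.
rewrite -(fineK (sigma_fin_num _ _ (uniform_haar R 'I_m.+1) _ e)) -EFinM.
have -> : ((n ^ #|V|)%:R%:E * mu A = \sum_z mu (S z))%E.
  under eq_bigr do rewrite muS.
  rewrite -(fineK (fin_num_measure mu _ mA)) sumEFin sumr_const -EFinM.
  by rewrite card_ffun card_ord mulr_natl.
apply: sum_measure_le => // x.
(* For fixed [x], these are the codes of the box vectors [z] with [x + phi z] in [A]. *)
pose B : set 'I_m.+1 := [set b | exists2 z, S z x & b = inZp (rho (dig z))].
have Bbase : coloring_base e B.
  exists (fun v => inZp (rho (delta v))); apply/translate_disjointP.
  move=> u v _ _ uv [z /SE Az ->] [z' /SE Az' ->] zz'.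
  apply: (fA u v _ _ uv Az Az'); rewrite -!addrA; congr (_ + _).
  by apply: phi_eq zz' => w; exact: ltn_ord.
have : (uniform_haar R 'I_m.+1 B <= sigma (uniform_haar R 'I_m.+1) e)%E.
  by apply: ereal_sup_ubound; exists B => //; split=> //; exact: measurable_finite.
rewrite -[leRHS](fineK (sigma_fin_num _ _ _ _ _)) lee_fin.
rewrite card_ord ler_pdivrMr ?ltr0n// mulrC; apply: le_trans.
rewrite ler_nat.
(* Distinct box vectors have distinct codes, so [B] has at least as many elements as there are such
   [z]. *)
have inj : {in [pred z | x \in S z] &, injective
    (fun z : {ffun V -> 'I_n} => inZp (rho (dig z)) : 'I_m.+1)}.
  have zn z w : (dig z w < n.+1)%N by rewrite ltnS; exact/ltnW/ltn_ord.
  move=> z z' _ _ /(congr1 val)/=.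
  rewrite !modn_small; [|exact/rho_lt/zn|exact/rho_lt/zn].
  move=> /(rho_inj _ _ (zn z) (zn z')) zz'; apply/ffunP => w; apply: val_inj.
  exact: (congr1 (@^~ w) zz').
rewrite -(card_in_image inj); apply/subset_leq_card/fintype.subsetP.
by move=> _ /fintype.imageP[z /set_mem Sz ->]; apply/mem_set; exists z.
Qed.

End cyclic_comparison.

(** * Vanishing of the boundary loss as the box grows *)

Section limits.
Local Open Scope ring_scope.

Lemma bernoulli_ge (R : realFieldType) (x : R) (k : nat) :
  0 <= x <= 1 -> 1 - x *+ k <= (1 - x) ^+ k.
Proof.
move=> /andP[x0 x1]; elim: k => [|k IHk]; first by rewrite mulr0n subr0 expr0.
rewrite exprS; apply: le_trans (ler_wpM2l _ IHk); last by rewrite subr_ge0.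
rewrite mulrBl mul1r mulrBr mulr1 mulrS.
have : 0 <= x * (x *+ k) by rewrite mulr_ge0// mulrn_wge0.
lra.
Qed.

(** By Bernoulli, (n/(n+1))^k is at least 1 - k/(n+1), which tends to 1. *)
Lemma le_expr_ratio_limit (R : archiRealFieldType) (k : nat) (a c : R) :
  0 <= a ->
  (forall n, (n ^ k)%:R * a <= (n.+1 ^ k)%:R * c) -> a <= c.
Proof.
move=> a0 ac.
suff ac_eps (eps : R) : 0 < eps -> a <= c + eps by exact/ler_addgt0Pr.
move=> eps0.
(* This [n] makes the loss a k/(n+1) at most [eps]. *)
have [n nE] : exists n, (a *+ k) / eps < n%:R.
  exists (Num.bound ((a *+ k) / eps)); apply: archi_boundP.
  by rewrite divr_ge0 ?mulrn_wge0// ltW.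
have n0 : 0 < n.+1%:R :> R by rewrite ltr0n.
have x01 : 0 <= (n.+1%:R^-1 : R) <= 1.
  by rewrite invr_ge0 ltW//= invf_le1// ler1n.
have : (1 - n.+1%:R^-1) ^+ k * a <= c.
  have -> : 1 - n.+1%:R^-1 = n%:R / n.+1%:R :> R.
    by rewrite -natr1; field; rewrite natr1 lt0r_neq0.
  rewrite expr_div_n mulrAC ler_pdivrMr ?exprn_gt0// [leRHS]mulrC.
  by rewrite -!natrX.
have := ler_wpM2r a0 (bernoulli_ge _ _ k x01).
have : n.+1%:R^-1 *+ k * a <= eps.
  rewrite mulrnAl -mulrnAr mulrC ler_pdivrMr// mulrC.
  move: nE; rewrite ltr_pdivrMr// => /ltW/le_trans; apply.
  by rewrite ler_wpM2r ?ler_nat// ltW.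
set X := n.+1%:R^-1 *+ k; set P := (_ ^+ _ * a); lra.
Qed.

End limits.

(** * Comparison of suprema *)

Section comparison.
Local Open Scope ring_scope.

(** The bound [c] is left free to serve both directions of the theorem: it is once the supremum over
    finite groups, once the value for the circle. *)
Lemma sigma_le_cyclic (R : realType) (Z : topologicalZmodType)
    (mu : haarProbability Z R) (V : finType) (e : rel V) (c : \bar R) :
  (forall m, (sigma (uniform_haar R 'I_m.+1) e <= c)%E) -> (sigma mu e <= c)%E.
Proof.
move=> cyc; apply: ge_ereal_sup => _ [A [mA Ae] <-].
have : (0 <= c)%E by apply: le_trans (cyc 0%N); exact: sigma_ge0.
case: c cyc => [c| |] cyc c0 //; last by rewrite leey.
have muA : mu A \is a fin_num by exact: fin_num_measure.
rewrite -(fineK muA) lee_fin; apply: (le_expr_ratio_limit _ #|V|).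
  exact/fine_ge0/measure_ge0.
move=> n; have mE : ((n.+1 ^ #|V|).-1.+1 = n.+1 ^ #|V|)%N.
  by rewrite prednK// expn_gt0.
have := sigma_cyclic_box _ _ mu _ _ n _ _ mE mA Ae.
rewrite mE -(fineK muA) -EFinM => /le_trans/(_ (lee_wpmul2l _ (cyc _))).
by rewrite -EFinM !lee_fin; apply.
Qed.

Lemma sigma_cyclic_le_circle (R : realType) (V : finType) (e : rel V) (m : nat) :
  (sigma (uniform_haar R 'I_m.+1) e <= sigma (circle_haar R) e)%E.
Proof.
apply: ge_ereal_sup => _ [A [_ [f /translate_disjointP fA]] <-].
pose q : R := m.+1%:R.
have q0 : 0 < q by rewrite ltr0n.
(* Open arcs are disjoint, and their union projects to an open, hence Borel, set. *)
pose arc (a : 'I_m.+1) : set R := `]a%:R / q, a.+1%:R / q[%classic.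
pose U := \bigcup_(a in A) arc a.
have arcE a x : arc a x -> a%:R < x * q < a%:R + 1.
  by rewrite /arc/= in_itv/= ltr_pdivrMr// ltr_pdivlMr// -natr1.
have arc01 a x : arc a x -> 0 < x < 1.
  move=> /arcE /andP[ax xa]; rewrite -(pmulr_lgt0 x q0) (le_lt_trans _ ax)//=.
  rewrite -(ltr_pM2r q0) mul1r (lt_le_trans xa)// /q natr1 ler_nat.
  exact: ltn_ord.
have oU : open U by apply: bigcup_open => a _; exact: itv_open.
have mu_arc a : lebesgue_measure (arc a : set (measurableTypeR R)) = q^-1%:E.
  rewrite lebesgue_measure_itv/= lte_fin ltr_pM2r ?invr_gt0// ltr_nat ltnSn.
  by rewrite -EFinB -mulrBl -natr1 addrAC subrr add0r mul1r.
have muU : lebesgue_measure (U : set (measurableTypeR R)) = uniform_haar R 'I_m.+1 A.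
  have -> : U = \big[setU/set0]_(a in [pred z : 'I_m.+1 | z \in A]) arc a.
    by rewrite -bigcup_pred /U; congr (\bigcup_(a in _) _);
      apply/seteqP; split=> a /=; rewrite inE.
  rewrite measure_bigsetU_ord//=.
  - under eq_bigr do rewrite mu_arc.
    rewrite sumEFin sumr_const /uniform_measure card_ord mulr_natl.
    by congr ((_ *+ _)%:E); exact: eq_card.
  - by move=> a; exact: measurable_itv.
  apply/trivIsetP => a b _ _ ab; apply/seteqP; split=> // x [].
  move=> /arcE/andP[ax xa] /arcE/andP[bx xb]; apply/negP : ab; rewrite negbK.
  have ab : (a%:R < b%:R + 1 :> R) by exact: lt_trans xb.
  have ba : (b%:R < a%:R + 1 :> R) by exact: lt_trans xa.
  by move: ab ba; rewrite !natr1 !ltr_nat !ltnS => ab ba; rewrite -val_eqE eqn_leq ab.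
(* Two points of [0, 1) that differ by an integer coincide. *)
have piU : @to_circle R @^-1` (@to_circle R @` U) `&` `[0, 1[ = U.
  apply/seteqP; split=> [t [[x [a Aa ax] /esym/to_circle_eq tx]]|t Ut] /=.
    rewrite in_itv/= => /andP[t0 t1].
    have /andP[x0 x1] := arc01 _ _ ax.
    have tx1 : `|t - x| < 1 by rewrite ltr_norml; apply/andP; split; lra.
    suff -> : t = x by exists a.
    apply/eqP; rewrite -subr_eq0; apply: contraTT tx1 => tx0.
    by rewrite -leNgt norm_intr_ge1.
  split; first by exists t.
  have [a Aa /arc01/andP[t0 t1]] := Ut.
  by rewrite in_itv/= t1 ltW.
rewrite /sigma; apply: ereal_sup_ubound.
exists (@to_circle R @` U : set (borel (circle R))); last first.
  by rewrite -muU -[in RHS]piU.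
split; first by apply: sub_sigma_algebra; exact: to_circle_open.
exists (fun v => to_circle (((f v : 'I_m.+1) : nat)%:R / q)).
apply/translate_disjointP.
move=> u v _ _ uv [x [a Aa /arcE/andP[ax xa]] <-] [y [b Ab /arcE/andP[yb bv]] <-].
rewrite -!to_circleD => /to_circle_eq/intrP[j jE].
apply: (fA u v a b uv Aa Ab); apply: val_inj => /=.
(* Since [x * q - a] and [y * q - b] lie in (0, 1), the integer [d] lies in (-1, 1) and vanishes;
   modulo [m.+1] this is the equality that [fA] forbids. *)
pose d : int := (a + f u)%N%:Z - (b + f v)%N%:Z - j * m.+1%:Z.
have dE : d%:~R = a%:R + (f u : nat)%:R - (b%:R + (f v : nat)%:R) - j%:~R * q.
  by rewrite /d !rmorphB/= rmorphM/= -!pmulrn !natrD.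
have jq : j%:~R * q = x * q + (f u : nat)%:R - (y * q + (f v : nat)%:R).
  by rewrite -jE; field; rewrite lt0r_neq0.
have d1 : (d < 1)%R by rewrite -(ltr_int R) dE jq; lra.
have d2 : (-1 < d)%R by rewrite -(ltr_int R) dE jq rmorphN; lra.
have d0 : d = 0 by lia.
have : (a + f u)%N%:Z = j * m.+1%:Z + (b + f v)%N%:Z by rewrite /d in d0; lia.
move=> /(congr1 (modz^~ m.+1%:Z)); rewrite modzMDl !modz_nat.
by case.
Qed.

End comparison.

Theorem corollary11 (R : realType) (V : finType) (e : rel V)
    (e_sym : symmetric e) (e_irr : irreflexive e) :
  sigma (circle_haar R) e =
  ereal_sup [set s | exists Z : finZmodType, s = sigma (uniform_haar R Z) e].
Proof.
apply/eqP; rewrite eq_le; apply/andP; split.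
  apply: sigma_le_cyclic => m; apply: ereal_sup_ubound.
  by exists ('I_m.+1 : finZmodType).
apply: ge_ereal_sup => _ [Z ->].
(* The averaging bound is applied to [Z] itself, with the circle dominating all cyclic groups. *)
by apply: sigma_le_cyclic => m; exact: sigma_cyclic_le_circle.
Qed.
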